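(* Let $m_1,\ldots,m_h$ be positive integers, let $G\in\mathcal{BG}(m_1+1,m_2+1,\ldots,m_h+1)$, let $1\leq k\leq m_1$, let $\underline{r}$ be a refinement of the multiset $\{k,m_1+1-k,m_2,\ldots,m_h\}$, and let $\sigma$ be a multiset of real numbers whose multiplicity list is $\underline{r}$. Then there is a matrix $A\in\mathcal{S}(G)$ with the strong spectral property and $\operatorname{spec}(A)=\sigma$.
   Context: A graph on at least 2 vertices is 2-connected if it is connected and remains connected after deleting any single vertex. A block of a graph is a maximal 2-connected induced subgraph. A block graph is a connected graph all of whose blocks are complete graphs; $\mathcal{BG}(b_1,\ldots,b_h)$ is the family of block graphs with exactly $h$ blocks, of sizes $b_1,\ldots,b_h$ (such a graph has $1+\sum_i(b_i-1)$ vertices). For a graph $G$ on $n$ vertices, $\mathcal{S}(G)$ is the set of $n\times n$ real symmetric matrices $(a_{ij})$ with, for $i\neq j$, $a_{ij}\neq0$ iff $\{i,j\}\in E(G)$. A real symmetric $A$ has the strong spectral property if the only real symmetric $X$ with $A\circ X=O$, $I\circ X=O$, $AX-XA=O$ is $X=O$. A refinement of a multiset of positive integers $\{a_1,\ldots,a_t\}$ is a multiset $\{b_{1,1},\ldots,b_{1,r_1},\ldots,b_{t,1},\ldots,b_{t,r_t}\}$ of positive integers with $\sum_{j}b_{i,j}=a_i$ for each $i$. The multiplicity list of a multiset of reals is the (unordered) multiset of multiplicities of its distinct elements. *)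

(* Defs.v *)
From HB Require Import structures.
From mathcomp Require Import all_boot all_order all_algebra.
From Stdlib Require Import Rdefinitions.
From mathcomp Require Import Rstruct.
Set Implicit Arguments. Unset Strict Implicit. Unset Printing Implicit Defensive.
Import Order.TTheory GRing.Theory Num.Theory.

Section Graphs.
Variable T : finType.

Definition simple_graph (e : rel T) := symmetric e /\ irreflexive e.

Definition induced_connected (e : rel T) (S : {set T}) :=
  forall x y, x \in S -> y \in S ->
    connect (fun u v => [&& e u v, u \in S & v \in S]) x y.

Definition connected_graph (e : rel T) := induced_connected e setT.

Definition two_connected (e : rel T) (S : {set T}) :=
  [/\ 1 < #|S|, induced_connected e S &
      forall v, v \in S -> induced_connected e (S :\ v)].

Definition is_block (e : rel T) (S : {set T}) :=
  two_connected e S /\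
  (forall S' : {set T}, S \subset S' -> two_connected e S' -> S' = S).

Definition complete_on (e : rel T) (S : {set T}) :=
  forall x y, x \in S -> y \in S -> x != y -> e x y.

Definition in_BG (e : rel T) (b : seq nat) :=
  connected_graph e /\
  exists B : 'I_(size b) -> {set T},
    [/\ injective B,
        forall i, is_block e (B i),
        forall S, is_block e S -> exists i, B i = S,
        forall i, complete_on e (B i) &
        forall i, #|B i| = nth 0%N b i].
End Graphs.

Local Open Scope ring_scope.

Definition in_SG (n : nat) (e : rel 'I_n) (A : 'M[R]_n) :=
  A^T = A /\ forall i j, i != j -> (A i j != 0) = e i j.

Definition SSP (n : nat) (A : 'M[R]_n) :=
  forall X : 'M[R]_n, X^T = X ->
    (forall i j, A i j * X i j = 0) ->
    (forall i, X i i = 0) ->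
    A *m X = X *m A -> X = 0.

Definition spectrum_is (n : nat) (A : 'M[R]_n) (sigma : seq R) :=
  char_poly A = \prod_(x <- sigma) ('X - x%:P).

(* multiplicity list of a multiset of reals (as a seq, up to permutation) *)
Definition mult_list (sigma : seq R) : seq nat :=
  [seq count_mem x sigma | x <- undup sigma].

Definition refinement (a r : seq nat) :=
  exists ss : seq (seq nat),
    [/\ map sumn ss = a, all (all (leq 1)) ss & perm_eq (flatten ss) r].

(* Main.v *)
(* Give every vertex [v] a real [d v] so that [d] enumerates [sigma], equal values
   only sit on adjacent vertices, and two vertices with equal values have a common
   neighbour with another value.  In a block graph this is possible: each vertex
   belongs to one block [i], the block [i] keeps all its vertices but one (all of
   them for the first block, which is split into [k] and [m1 + 1 - k] vertices),
   and distinct parts receive disjoint sets of eigenvalues.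
   Let [D = diag d] and let [W] be a symmetric matrix with the pattern of the graph.
   Among the matrices [A = Q^T D Q] close to [D], minimise the sum of
   [(A i j - t W i j)^2] over the pairs with [d i <> d j].  At a minimiser [A]
   commutes with the residual, which vanishes where [d i = d j]; since [A] is close
   to [D], the residual is zero (the same argument gives the strong spectral
   property).  Hence the entries of [A] with [d i <> d j] are exactly [t W i j].  As
   [d j] keeps its multiplicity, the entries with [d i = d j], [i <> j], are given by
   a Schur complement, namely
   [t^2 (sum_(d l <> d j) W j l W l i / (d l - d j) + o(1))], which is nonzero for
   small [t] and generic [W]. *)
Require Import Defs.
From HB Require Import structures.
From mathcomp Require Import all_boot all_order all_algebra.
From Stdlib Require Import Rdefinitions.
From mathcomp Require Import Rstruct.
From mathcomp Require Import boolp.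
From mathcomp Require Import ring lra.
Set Implicit Arguments. Unset Strict Implicit. Unset Printing Implicit Defensive.
Import Order.TTheory GRing.Theory Num.Theory.

(** * Block graphs *)

Section Blocks.
Variables (T : finType) (e : rel T).
Hypothesis e_sym : symmetric e.
Implicit Types (S U B : {set T}).

Let rin S := [rel u v | [&& e u v, u \in S & v \in S]].

Let rin_sym S : connect_sym (rin S).
Proof. by apply: sym_connect_sym => u v /=; rewrite e_sym [(u \in S) && _]andbC. Qed.

Lemma induced_connectedP S c :
  (forall x, x \in S -> connect (rin S) x c) -> induced_connected e S.
Proof. by move=> H x y /H xc /H yc; apply: connect_trans xc _; rewrite rin_sym. Qed.

Lemma star_connected S c : c \in S ->
  (forall x, x \in S -> x != c -> e x c) -> induced_connected e S.
Proof.
move=> cS H; apply: (@induced_connectedP _ c) => x xS.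
have [->|xc] := eqVneq x c; first exact: connect0.
by apply: connect1; rewrite /= H ?xS.
Qed.

Lemma complete_connected S : complete_on e S -> induced_connected e S.
Proof.
move=> H x y xS yS; have [->|xy] := eqVneq x y; first exact: connect0.
by apply: connect1; rewrite /= H // xS.
Qed.

Lemma edge_two_connected u v : irreflexive e -> e u v -> two_connected e [set u; v].
Proof.
move=> irr uv.
have uNv : u != v by apply: contraTneq uv => ->; rewrite irr.
have C : complete_on e [set u; v].
  by move=> x y /set2P[] -> /set2P[] ->; rewrite ?eqxx // e_sym.
split; first by rewrite cards2 uNv.
  exact: complete_connected.
move=> w _; apply: complete_connected => x y /setD1P[_ xS] /setD1P[_ yS].
exact: C.
Qed.

Lemma two_connected_block S : two_connected e S ->
  exists2 B, is_block e B & S \subset B.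
Proof.
move=> tS; have [|B /maxsetP[/asboolP tB maxB] SB] :=
  @maxset_exists _ (fun S => `[< two_connected e S >]) S; first exact/asboolP.
exists B => //; split=> // S' BS' /asboolP tS'; exact: maxB.
Qed.

(** In the union of the two blocks [a] and [c] are each adjacent to every other vertex, and one of
    them survives any deletion. So the union is 2-connected, and maximality identifies both blocks
    with it. *)
Lemma complete_blocks_meet B B' a c : is_block e B -> is_block e B' ->
  complete_on e B -> complete_on e B' -> a != c ->
  a \in B -> c \in B -> a \in B' -> c \in B' -> B = B'.
Proof.
move=> [tB mB] [tB' mB'] cB cB' ac aB cB0 aB' cB'0.
have star x b : b \in B -> b \in B' -> x \in B :|: B' -> x != b -> e x b.
  by move=> bB bB' /setUP[xB|xB'] xb; [exact: cB|exact: cB'].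
have tU : two_connected e (B :|: B').
  split; first by apply/card_gt1P; exists a, c; rewrite !inE aB cB0.
    by apply: (@star_connected _ a) => [|x xS]; [rewrite !inE aB|exact: star].
  move=> v _; have [->|va] := eqVneq v a.
    apply: (@star_connected _ c) => [|x /setD1P[_ xS]]; last exact: star.
    by rewrite !inE eq_sym ac cB0.
  apply: (@star_connected _ a) => [|x /setD1P[_ xS]]; last exact: star.
  by rewrite !inE eq_sym va aB.
by rewrite -(mB _ (subsetUl _ _) tU) -[RHS](mB' _ (subsetUr _ _) tU).
Qed.

Lemma sorted_connect S q : sorted e q -> {subset q <= S} ->
  forall z z', z \in q -> z' \in q -> connect (rin S) z z'.
Proof.
case: q => // u p /= pth qS.
have pin : path (rin S) u p.
  elim: p u pth qS => //= b p IH u /andP[ub pth] qS.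
  rewrite /= ub !qS ?inE ?eqxx ?orbT //=; apply: IH => // z zp.
  by apply: qS; rewrite inE zp orbT.
move=> z z' zq z'q; apply: (@connect_trans _ _ u).
  by rewrite rin_sym; exact: (path_connect pin).
exact: (path_connect pin).
Qed.

(** Deleting [x] from this cycle leaves the path. Deleting a vertex [y] of the path leaves at most
    two segments, each with an end adjacent to [x]. *)
Lemma cycle_two_connected x u p : path e u p -> uniq (u :: p) -> p != [::] ->
  x \notin u :: p -> e x u -> e x (last u p) ->
  two_connected e [set z in x :: u :: p].
Proof.
move=> pth uq pN xN xu xw.
set q := u :: p in uq xN *; set S := [set z in _].
have qS z : z \in q -> z \in S by rewrite !inE => ->; rewrite orbT.
have xS : x \in S by rewrite inE mem_head.
have srt : sorted e q by [].
have uq' : u \in q by exact: mem_head.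
have SE z : z \in S -> z != x -> z \in q by rewrite inE in_cons => /orP[/eqP ->|//]; rewrite eqxx.
split.
- by apply/card_gt1P; exists x, u; rewrite xS qS //; split=> //; apply: contraNneq xN => ->.
- apply: (@induced_connectedP _ u) => z zS.
  have [->|zx] := eqVneq z x; first by apply: connect1; rewrite /= xu xS qS.
  by apply: (sorted_connect srt) => //; exact: SE.
move=> y yS; have [->|yx] := eqVneq y x.
  apply: (@induced_connectedP _ u) => z /setD1P[zx zS].
  apply: (sorted_connect srt) => // [t tq|]; last exact: SE.
  by rewrite in_setD1 qS // andbT; apply: contraNneq xN => <-.
have yq := SE _ yS yx.
apply: (@induced_connectedP _ x) => z /setD1P[zy zS].
have xS' : x \in S :\ y by rewrite in_setD1 eq_sym yx.
have [->|zx] := eqVneq z x; first exact: connect0.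
have zq := SE _ zS zx.
have wE : last u q = last u p by [].
have uE : head u q = u by [].
rewrite -wE in xw; rewrite -uE in xu; clear pth uq' wE uE.
clearbody q; case/splitPr: yq srt uq zq qS xN xu xw SE => q1 q2.
move=> srt uq zq qS xN xu xw SE.
have [s1 /path_sorted s2] := cat_sorted2 srt.
move: uq; rewrite cat_uniq /= negb_or => /and3P[_ /andP[yq1 _] /andP[yq2 _]].
have sub1 : {subset q1 <= S :\ y}.
  move=> t t1; rewrite in_setD1 qS ?mem_cat ?t1 // andbT.
  by apply: contraNneq yq1 => <-.
have sub2 : {subset q2 <= S :\ y}.
  move=> t t2; rewrite in_setD1 qS ?mem_cat ?inE ?t2 ?orbT // andbT.
  by apply: contraNneq yq2 => <-.
have toX t : e x t -> t \in S :\ y -> connect (rin (S :\ y)) t x.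
  by move=> xt tS; apply: connect1; rewrite /= e_sym xt tS.
move: zq; rewrite mem_cat in_cons (negbTE zy) /= => /orP[z1|z2].
  case: q1 z1 s1 sub1 xu {srt qS xN xw SE yq1} => // b q1 z1 s1 sub1 /= xb.
  apply: (connect_trans (sorted_connect s1 sub1 z1 (mem_head _ _))).
  by apply: toX => //; apply: sub1; exact: mem_head.
case: q2 z2 s2 sub2 xw {srt qS xN xu SE yq2} => // b q2 z2 s2 sub2.
rewrite last_cat /= => xb.
apply: (connect_trans (sorted_connect s2 sub2 z2 (mem_last _ _))).
by apply: toX => //; apply: sub2; exact: mem_last.
Qed.

Hypothesis e_irr : irreflexive e.
Hypothesis blocks_complete : forall B, is_block e B -> complete_on e B.

(** If [u] and [w] differed, a simple path between them in [U] would form with [x] a cycle,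
    contained in a block. That block shares the first edge of the path with a block inside [U],
    hence equals it, and [x] would lie in [U]. *)
Lemma unique_neighbour U x u w : induced_connected e U ->
  (forall a b, a \in U -> b \in U -> e a b ->
     exists B, [/\ is_block e B, B \subset U, a \in B & b \in B]) ->
  x \notin U -> u \in U -> w \in U -> e x u -> e x w -> u = w.
Proof.
move=> cU eU xU uU wU xu xw; apply/eqP/negPn/negP => uw.
have /connectP[p0 pth0 wE0] := cU u w uU wU.
case/shortenP: pth0 wE0 => p pth uq _ wE {p0}.
have pU : {subset u :: p <= U}.
  elim: p u uU pth {uq wE xu uw} => [|b p IH] u uU /=; first by move=> _ z; rewrite inE => /eqP ->.
  case/andP=> /and3P[_ _ bU] pth z; rewrite in_cons => /orP[/eqP -> //|].
  exact: IH.
have epth : path e u p by apply: sub_path pth => a b /and3P[].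
have pN : p != [::] by apply: contraNneq uw => p0; rewrite wE p0.
have xN : x \notin u :: p by apply: contra xU; exact: pU.
have xl : e x (last u p) by rewrite -wE.
have [B bB SB] := two_connected_block (cycle_two_connected epth uq pN xN xu xl).
case: p pN pU epth uq SB {xN xl pth wE} => // b p _ pU /= /andP[ub _] /and3P[uNb _ _] SB.
have bU : b \in U by apply: pU; rewrite !inE eqxx orbT.
have [B' [bB' B'U uB' bB'']] := eU u b uU bU ub.
have inB z : z \in [:: x, u, b & p] -> z \in B by move=> zS; apply: (subsetP SB); rewrite inE.
have BB : B = B'.
  apply: (complete_blocks_meet (a := u) (c := b)) => //; try exact: blocks_complete.
  - by move: uNb; rewrite inE negb_or => /andP[].
  - by apply: inB; rewrite !inE eqxx !orbT.
  - by apply: inB; rewrite !inE eqxx !orbT.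
by case/negP: xU; apply: (subsetP B'U); rewrite -BB inB // mem_head.
Qed.


(** * Assigning vertices to blocks, one block at a time *)

Section Growth.
Variables (I : finType) (B : I -> {set T}) (i0 : I).
Hypothesis B_inj : injective B.
Hypothesis B_block : forall i, is_block e (B i).
Hypothesis block_B : forall S, is_block e S -> exists i, B i = S.

(* [U] is a union of blocks, [pi] assigns each of its vertices to one of them, and
   [par i] is the only vertex of block [i <> i0] that is not assigned to [i]. *)
Definition block_labelling U (pi : T -> I) (par : I -> T) :=
  [/\ B i0 \subset U,
      forall v, v \in U -> v \in B (pi v) /\ B (pi v) \subset U,
      forall v, v \in B i0 -> pi v = i0 &
      forall i, i != i0 -> B i \subset U ->
        [/\ par i \in B i, par i \in U, pi (par i) != i &
            forall v, v \in B i -> v != par i -> pi v = i]].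

Lemma B_complete i : complete_on e (B i).
Proof. exact: blocks_complete. Qed.

Lemma B_meet i j a c : a != c -> a \in B i -> c \in B i -> a \in B j -> c \in B j -> i = j.
Proof.
by move=> ac ? ? ? ?; apply/B_inj/(complete_blocks_meet (a := a) (c := c)) => //; exact: B_complete.
Qed.

Lemma edge_block u v : e u v -> exists i, u \in B i /\ v \in B i.
Proof.
move=> uv; have [S bS uvS] := two_connected_block (edge_two_connected e_irr uv).
have [i BS] := block_B bS; exists i; rewrite BS.
by split; apply: (subsetP uvS); rewrite !inE eqxx ?orbT.
Qed.

Lemma block_other i u : exists2 v, v \in B i & v != u.
Proof.
have [[/card_gt1P[a [c [aB cB ac]]] _ _] _] := B_block i.
by have [au|] := eqVneq a u; [exists c; rewrite -?au 1?eq_sym|exists a].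
Qed.

(** An edge [uv] leaving [U] lies in a block [B i], which by [unique_neighbour] meets [U] in [u]
    alone. So [u] serves as [par i], the other vertices of [B i] are assigned to [i], and the
    earlier data are kept. *)
Lemma grow_labelling U pi par : connected_graph e -> induced_connected e U ->
  (forall a b, a \in U -> b \in U -> e a b ->
     exists i, [/\ B i \subset U, a \in B i & b \in B i]) ->
  block_labelling U pi par -> U != setT ->
  exists U' pi' par', [/\ U \proper U', induced_connected e U',
    forall a b, a \in U' -> b \in U' -> e a b ->
      exists i, [/\ B i \subset U', a \in B i & b \in B i] &
    block_labelling U' pi' par'].
Proof.
move=> conn cU eU [B0U piU pi0 parU] UN.
have [u [v [uU vU uv]]] : exists u v, [/\ u \in U, v \notin U & e u v].
  have [a aB _] : exists2 v, v \in B i0 & v != (par i0) by exact: block_other.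
  have aU := subsetP B0U _ aB.
  have [b bU] : exists b, b \notin U.
    by apply/existsP; rewrite -negb_forall; apply: contra UN => /forallP H; apply/eqP/setP => z; rewrite inE H.
  have /connectP[p pth bE] : connect (rin setT) a b by apply: conn; rewrite inE.
  elim: p a aU pth bE {aB} => [|c p IH] a aU /=; first by move=> _ ba; rewrite ba aU in bU.
  case/andP=> /andP[ac _] pth bE.
  by have [cU'|cU'] := boolP (c \in U); [exact: IH pth bE|exists a, c].
have [i [ui vi]] := edge_block uv.
have uN x w : x \notin U -> w \in U -> e x u -> e x w -> w = u.
  move=> xU wU xu xw; apply: (unique_neighbour cU _ xU wU uU xw xu) => a b aU bU ab.
  by have [j [jU aj bj]] := eU a b aU bU ab; exists (B j).
have uniq_u z : z \in B i -> z \in U -> z = u.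
  move=> zi zU; apply: (uN v) => //; first by rewrite e_sym.
  by apply: (B_complete vi zi); apply: contraNneq vU => ->.
have iU j : B j \subset U -> j != i.
  by move=> jU; apply: contraNneq vU => ji; apply: (subsetP jU); rewrite ji.
have edgeU x w : x \in B i -> x \notin U -> w \in U -> e x w -> w = u.
  move=> xi xU wU xw; apply: (uN x) => //; apply: (B_complete xi ui).
  by apply: contraNneq xU => ->.
(* A vertex [z] of [B j] outside [U] lies in [B i]. Any other vertex of [B j] is then outside [B i],
   hence in [U]; but an edge from [z] into [U] ends at [u], which is in [B i]. *)
have oldB j : j != i -> B j \subset U :|: B i -> B j \subset U.
  move=> ji jU; apply/subsetP => z zj; apply/negPn/negP => zU.
  have zi : z \in B i by have := subsetP jU _ zj; rewrite inE (negbTE zU).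
  have [y yj yz] := block_other j z.
  have yNi : y \notin B i.
    by apply: contra ji => yi; apply/eqP; exact: (B_meet yz).
  have yU : y \in U by have := subsetP jU _ yj; rewrite inE (negbTE yNi) orbF.
  have yu : y = u by apply: (edgeU z) => //; apply: (B_complete zj yj); rewrite eq_sym.
  by rewrite yu ui in yNi.
exists (U :|: B i), (fun z => if z \in U then pi z else i), (fun j => if j == i then u else par j).
split.
- rewrite properE subsetUl /=; apply/subsetPn; exists v => //.
  by rewrite inE vi orbT.
- apply: (@induced_connectedP _ u) => z /setUP[zU|zi].
    apply: connect_sub (cU z u zU uU) => a b /and3P[ab aU bU]; apply: connect1.
    by rewrite /= ab !inE aU bU.
  have [->|zu] := eqVneq z u; first exact: connect0.
  by apply: connect1; rewrite /= (B_complete zi ui zu) !inE zi uU orbT.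
- have cross a b : a \in U -> b \in B i -> b \notin U -> e b a -> a \in B i.
    by move=> aU bi bU ba; rewrite (edgeU b a).
  have Bi : B i \subset U :|: B i by exact: subsetUr.
  move=> a b; have [aU _|aU] := boolP (a \in U).
    have [bU _|bU] := boolP (b \in U).
      move=> /(eU a b aU bU) [j [jU aj bj]]; exists j; split=> //.
      by apply: subset_trans jU _; exact: subsetUl.
    rewrite inE (negbTE bU) /= => bi; rewrite e_sym => ba.
    by exists i; split => //; exact: (cross a b).
  rewrite inE (negbTE aU) /= => ai.
  have [bU _|bU] := boolP (b \in U).
    by move=> ab; exists i; split => //; exact: (cross b a).
  by rewrite inE (negbTE bU) /= => bi _; exists i.
split.
- by apply: subset_trans B0U _; exact: subsetUl.
- move=> z /setUP[zU|zi].
    rewrite zU; have [zp pU] := piU z zU; split=> //.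
    by apply: subset_trans pU _; exact: subsetUl.
  case: ifP => zU; last by split=> //; exact: subsetUr.
  have [zp pU] := piU z zU; split=> //.
  by apply: subset_trans pU _; exact: subsetUl.
- by move=> z z0; rewrite (subsetP B0U) // pi0.
move=> j j0 jU; have [jE|ji] := eqVneq j i.
  rewrite jE; split=> //; first by rewrite inE uU.
    by rewrite uU; have [_ pU] := piU u uU; exact: iU.
  move=> z zi zu; case: ifP => // zU.
  by rewrite (uniq_u z zi zU) eqxx in zu.
have jU' := oldB j ji jU.
have [p1 p2 p3 p4] := parU j j0 jU'.
split=> //; first by rewrite inE p2.
  by rewrite p2.
by move=> z zj zp; rewrite (subsetP jU' z zj) p4.
Qed.

Lemma block_labelling_total : connected_graph e ->
  exists pi par, block_labelling setT pi par.
Proof.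
move=> conn.
have [v0 v0B _] : exists2 v, v \in B i0 & true.
  have [[/card_gt1P[a [c [aB cB ac]]] _ _] _] := B_block i0; by exists a.
(* Induction on the number of uncovered vertices, starting from the block [i0]. *)
suff H m U pi par : #|~: U| <= m -> induced_connected e U ->
    (forall a b, a \in U -> b \in U -> e a b ->
      exists i, [/\ B i \subset U, a \in B i & b \in B i]) ->
    block_labelling U pi par -> exists pi par, block_labelling setT pi par.
  apply: (H _ (B i0) (fun=> i0) (fun=> v0) (leqnn _)).
  - by have [[]] := B_block i0.
  - by move=> a b aB bB _; exists i0.
  split=> // i ii0 iB.
  have [[/card_gt1P[a [c [ai ci ac]]] _ _] _] := B_block i.
  case/eqP: ii0; apply: (B_meet ac) => //; exact: (subsetP iB).
elim: m U pi par => [|m IH] U pi par.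
  rewrite leqn0 cards_eq0 => /eqP UE _ _ L; exists pi, par.
  by rewrite -(setCK U) UE setC0 in L.
move=> Um cU eU L; have [UT|UN] := eqVneq U setT; first by exists pi, par; rewrite -UT.
have [U' [pi' [par' [UU' cU' eU' L']]]] := grow_labelling conn cU eU L UN.
apply: (IH U' pi' par') => //; rewrite -ltnS; apply: leq_trans Um.
by apply: proper_card; rewrite properC.
Qed.

End Growth.
End Blocks.

Lemma subset_of_card (T : finType) (A : {set T}) k :
  k <= #|A| -> exists2 K : {set T}, K \subset A & #|K| = k.
Proof.
move=> kA; exists [set x in take k (enum A)].
  by apply/subsetP => x; rewrite inE => /mem_take; rewrite mem_enum.
rewrite cardsE (card_uniqP _) ?take_uniq ?enum_uniq // size_take_min -cardE.
exact/minn_idPl.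
Qed.

(** Label [0] goes to a [k]-subset [K] of block [i0], label [1] to the rest of that block, and label
    [i.+1] to the vertices assigned to another block [i]. The common neighbour is the [par] vertex
    of the block or, in block [i0], a vertex of the other part. *)
Lemma in_BG_labels (T : finType) (e : rel T) m1 ms k :
  simple_graph e -> in_BG e (map S (m1 :: ms)) -> 0 < k <= m1 ->
  exists gamma : T -> nat,
    (forall j, #|[set v | gamma v == j]| = nth 0 (k :: m1.+1 - k :: ms) j) /\
    forall u v, u != v -> gamma u = gamma v ->
      e u v /\ exists l, [/\ e u l, e v l & gamma l != gamma u].
Proof.
move=> [es ei] [conn [B [Binj Bb bB Bc cardB]]] /andP[k0 km].
have bc S : is_block e S -> complete_on e S by move=> /bB[i <-]; exact: Bc.
set h := size _ in B Binj Bb bB Bc cardB.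
pose i0 : 'I_h := ord0.
have [pi [par [_ piB pi0 parB]]] := block_labelling_total es ei bc i0 Binj Bb bB conn.
have {}piB v : v \in B (pi v) by have [] := piB v (in_setT v).
have {}parB i : i != i0 -> [/\ par i \in B i, pi (par i) != i &
    forall v, v \in B i -> v != par i -> pi v = i].
  by move=> /parB/(_ (subsetT _))[].
have card0 : #|B i0| = m1.+1 by rewrite cardB.
have [K KB cardK] : exists2 K : {set T}, K \subset B i0 & #|K| = k.
  by apply: subset_of_card; rewrite card0 ltnW.
pose gamma v := if pi v == i0 then (if v \in K then 0 else 1) else (pi v).+1.
have i0E (i : 'I_h) : (i == i0) = (i == 0 :> nat) by [].
have fib0 v : (pi v == i0) = (v \in B i0).
  by apply/eqP/idP => [<-|/pi0].
exists gamma; split.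
  case=> [|[|j]] /=.
  - rewrite -cardK; apply: eq_card => v; rewrite inE /gamma fib0.
    by case: ifPn => [_|vB]; [case: (v \in K)|apply/esym/negbTE; apply: contra vB; exact: (subsetP KB)].
  - rewrite -card0 -cardK -[in RHS](setIidPr KB) -cardsD.
    apply: eq_card => v; rewrite !inE /gamma fib0.
    case: ifPn => [_|vB]; first by case: (v \in K).
    by rewrite eqSS -[_ == _](i0E (pi v)) fib0 (negbTE vB) andbF.
  have fibS v : gamma v = j.+2 -> pi v = j.+1 :> nat.
    by rewrite /gamma; case: ifP => _; [case: ifP|move=> []].
  have [jms|msj] := ltnP j (size ms); last first.
    rewrite nth_default //; apply/eqP; rewrite cards_eq0; apply/eqP/setP => v.
    rewrite !inE; apply/negbTE/eqP => /fibS pv.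
    by have := ltn_ord (pi v); rewrite pv /h /= size_map ltnS ltnNge msj.
  have jh : j.+1 < h by rewrite /h /= size_map ltnS.
  pose i : 'I_h := Ordinal jh.
  have ii0 : i != i0 by rewrite i0E.
  have [parBi parN piE] := parB i ii0.
  have : #|B i| = (nth 0 ms j).+1 by rewrite cardB /= (nth_map 0).
  rewrite (cardsD1 (par i)) parBi => -[<-].
  apply: eq_card => v; rewrite !inE; apply/eqP/andP => [/fibS pv|[vp vB]].
    have pvi : pi v = i by exact: val_inj.
    by split; [apply: contraNneq parN => <-; rewrite pvi|rewrite -pvi].
  by rewrite /gamma piE // (negbTE ii0).
have fibN (i : 'I_h) : i != i0 -> 0 < i by rewrite i0E lt0n.
move=> u v uv guv.
have puv : pi u = pi v.
  move: guv; rewrite /gamma.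
  case: eqVneq => [->|/fibN pu]; case: eqVneq => [-> //|/fibN pv].
  - by case: ifP => _ // [pv0]; rewrite -pv0 in pv.
  - by case: ifP => _ // [pu0]; rewrite pu0 in pu.
  by case=> /val_inj.
have vB : v \in B (pi u) by rewrite puv.
split; first exact: Bc (piB u) vB uv.
suff [l lB gl] : exists2 l, l \in B (pi u) & gamma l != gamma u.
  exists l; split => //; [apply: Bc (piB u) lB _|apply: Bc vB lB _];
    by apply: contraNneq gl => <-; rewrite ?guv.
have [p0|pN0] := eqVneq (pi u) i0; last first.
  have [pB pN _] := parB _ pN0; exists (par (pi u)) => //.
  rewrite /gamma (negbTE pN0); case: ifP => _ //.
  have := fibN _ pN0; case: ifP => _; rewrite // eqSS.
  by case: (nat_of_ord (pi u)).
rewrite p0 /gamma p0 eqxx.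
case: ifP => uK.
  have : 0 < #|B i0 :\: K| by rewrite cardsD (setIidPr KB) card0 cardK subn_gt0.
  case/card_gt0P => l /setDP[lB lK]; exists l => //.
  by rewrite fib0 lB (negbTE lK).
have /card_gt0P[l lK] : 0 < #|K| by rewrite cardK.
exists l; first exact: (subsetP KB).
by rewrite lK fib0 (subsetP KB).
Qed.

(** * Distributing the eigenvalues *)

(** Serves to match multiplicities with tagged parts of the refinement, and then vertices with
    eigenvalues. *)
Lemma perm_map_lift (T1 T2 : eqType) (f : T1 -> T2) s t :
  perm_eq s (map f t) -> exists2 t', perm_eq t' t & s = map f t'.
Proof.
elim: s t => [|x s IH] t; first by rewrite perm_sym => /perm_nilP; case: t => // _; exists [::].
move=> st; have : x \in map f t by rewrite -(perm_mem st) mem_head.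
case/mapP => y yt xE.
have [|t' t't sE] := IH (rem y t).
  rewrite -(perm_cons x); apply: perm_trans st _.
  by rewrite xE -map_cons; apply: perm_map; exact: perm_to_rem.
exists (y :: t'); last by rewrite /= -xE sE.
by apply: perm_trans (_ : perm_eq (y :: rem y t) t); rewrite ?perm_cons // perm_sym perm_to_rem.
Qed.

Lemma count_undup (T : eqType) (s : seq T) (P : pred T) :
  count P s = \sum_(x <- undup s | P x) count_mem x s.
Proof.
rewrite -sum1_count -[RHS](eq_bigr _ (fun x _ => muln1 (count_mem x s))).
rewrite -big_undup_iterop_count; apply: eq_bigr => x _.
by rewrite Monoid.iteropE iter_addn_0 muln1 mul1n.
Qed.

(** Each part of the refinement is tagged with the index of the entry it refines. Matching the
    tagged parts with the distinct values of [sigma] gives each value the tag of its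
    multiplicity. *)
Lemma refinement_labels (T : eqType) (sigma : seq T) (a r : seq nat) :
  refinement a r -> perm_eq [seq count_mem x sigma | x <- undup sigma] r ->
  exists g : T -> nat, forall j, count_mem j (map g sigma) = nth 0 a j.
Proof.
move=> [ss [<- _ ssr]] sr.
pose P := flatten [seq [seq (c, j) | c <- nth [::] ss j] | j <- iota 0 (size ss)].
have PE : map fst P = flatten ss.
  rewrite map_flatten -map_comp -[in RHS](mkseq_nth [::] ss) /mkseq; congr flatten.
  by apply: eq_map => j /=; rewrite -map_comp /= map_id.
have [|P' P'P sE] := @perm_map_lift _ _ fst [seq count_mem x sigma | x <- undup sigma] P.
  by rewrite PE; apply: perm_trans sr _; rewrite perm_sym.
have szP : size P' = size (undup sigma) by rewrite -(size_map fst) -sE size_map.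
pose g x := (nth (0, 0) P' (index x (undup sigma))).2.
exists g => j; rewrite count_map count_undup.
transitivity (\sum_(p <- P' | p.2 == j) p.1).
  case: (undup sigma) (undup_uniq sigma) @g szP sE => [|x0 s] us g szP sE.
    by move: szP => /size0nil ->; rewrite !big_nil.
  rewrite (big_nth x0) (big_nth (0, 0)) szP; apply: congr_big_nat => // i /= ilt.
    by rewrite /g index_uniq.
  case/andP: ilt => _ ilt; transitivity (nth 0 (map fst P') i); first by rewrite -sE (nth_map x0).
  by rewrite (nth_map (0, 0)) ?szP.
rewrite (perm_big _ P'P) /P big_flatten big_map.
have inner j' : \sum_(p <- [seq (c, j') | c <- nth [::] ss j'] | p.2 == j) p.1 =
    if j' == j then sumn (nth [::] ss j') else 0.
  by rewrite big_map /=; case: eqP => _; rewrite ?big_pred0_eq // sumnE.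
rewrite (eq_bigr _ (fun j' _ => inner j')).
have [jlt|jge] := ltnP j (size ss).
  rewrite (bigD1_seq j) ?mem_iota ?iota_uniq //= eqxx big1 ?addn0 ?(nth_map [::]) //.
  by move=> i /negbTE ->.
rewrite nth_default ?size_map // big_seq big1 // => i.
by rewrite mem_iota add0n => /= ilt; case: eqP => // ij; rewrite ij ltnNge jge in ilt.
Qed.

Lemma assign_values (R : eqType) (x0 : R) n (gamma : 'I_n -> nat) (g : R -> nat) (sigma : seq R) :
  (forall j, count_mem j (map g sigma) = #|[set v | gamma v == j]|) ->
  exists2 d : 'I_n -> R, perm_eq [seq d i | i <- enum 'I_n] sigma &
    forall u, g (d u) = gamma u.
Proof.
move=> H.
have pm : perm_eq (map gamma (enum 'I_n)) (map g sigma).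
  apply/allP => j _; apply/eqP => /=; rewrite H count_map -size_filter cardE.
  by congr size; rewrite /enum_mem -filter_predI; apply: eq_filter => v; rewrite /= !inE andbT.
have [s' s's gE] := perm_map_lift pm.
have sz : size s' = n by rewrite -(size_map g) -gE size_map size_enum_ord.
exists (fun i => nth x0 s' i).
  rewrite (_ : [seq _ | i <- _] = s') //.
  by rewrite -[RHS](mkseq_nth x0) /mkseq sz -val_enum_ord -map_comp.
move=> u; have /(congr1 (fun s => nth 0 s u)) := gE.
rewrite (nth_map u) ?size_enum_ord // nth_ord_enum => ->.
by rewrite (nth_map x0) ?sz.
Qed.

(** * Matrices near a diagonal matrix *)

Local Open Scope ring_scope.

Definition conj_diag (R : realFieldType) n (d : 'rV[R]_n) (Q : 'M[R]_n) : 'M[R]_n :=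
  Q^T *m diag_mx d *m Q.

Lemma conj_diagE (R : realFieldType) n (d : 'rV[R]_n) Q i j :
  conj_diag d Q i j = \sum_k Q k i * d 0 k * Q k j.
Proof.
rewrite /conj_diag mxE; apply: eq_bigr => k _.
by rewrite mul_mx_diag !mxE.
Qed.

Definition misfit (R : realFieldType) n (c W A : 'M[R]_n) : R :=
  \sum_i \sum_j c i j * (A i j - W i j) ^+ 2.

Definition near_diag (R : realFieldType) n (d : 'rV[R]_n) (eps : R) (A : 'M[R]_n) :=
  forall i j, `|A i j - diag_mx d i j| <= eps.

Lemma fin_lower_bound (R : realFieldType) (I : finType) (P : pred I) (f : I -> R) :
  (forall i, P i -> 0 < f i) ->
  exists2 del, 0 < del & forall i, P i -> del <= f i.
Proof.
(* The seed [1] covers the case of no index in [P]. *)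
move=> f0; exists (\big[Order.min/1]_(i | P i) f i).
  by elim/big_ind: _ => // x y x0 y0; rewrite lt_min x0.
by move=> i Pi; rewrite (bigminD1 i) // ge_min lexx.
Qed.

Lemma ler_norm_sumC (R : numDomainType) n (P : pred 'I_n) (f : 'I_n -> R) (b : R) :
  0 <= b -> (forall i, P i -> `|f i| <= b) -> `|\sum_(i | P i) f i| <= n%:R * b.
Proof.
move=> b0 fb; apply: le_trans (ler_norm_sum _ _ _) _.
apply: le_trans (_ : \sum_(i < n) b <= _).
  rewrite big_mkcond; apply: ler_sum => i _.
  by case: ifP => // /fb.
by rewrite sumr_const card_ord mulr_natl.
Qed.

Lemma ler_sum_entry (R : numDomainType) (I J : finType) (f : I -> J -> R) u v :
  (forall i j, 0 <= f i j) -> f u v <= \sum_i \sum_j f i j.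
Proof.
move=> f0; rewrite (bigD1 u) //= (bigD1 v) //= -addrA lerDl addr_ge0 //.
  exact: sumr_ge0.
by apply: sumr_ge0 => i _; exact: sumr_ge0.
Qed.

Section NearDiagonal.
Variables (R : realFieldType) (n : nat) (d : 'rV[R]_n) (del eps : R).
Hypothesis eps_ge0 : 0 <= eps.
Hypothesis gap : forall i j, d 0 i != d 0 j -> del <= `|d 0 i - d 0 j|.
Hypothesis eps_small : 4 * (n%:R * eps) < del.
Implicit Types (A X : 'M[R]_n).

Let del_gt0 : 0 < del.
Proof.
apply: le_lt_trans eps_small.
by rewrite !mulr_ge0.
Qed.

(** At an entry of maximal modulus commutation reads [(d u - d v) X u v = (X E - E X) u v] with
    [E = A - D]. The right side is at most [2 n eps |X u v|], which is below [del |X u v|] unless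
    the entry is zero. *)
Lemma commute_near_diag A X : near_diag d eps A -> A *m X = X *m A ->
  (forall i j, d 0 i = d 0 j -> X i j = 0) -> X = 0.
Proof.
move=> nA AX X0; apply/matrixP => i0 j0; rewrite [RHS]mxE.
case: (@Order.TotalTheory.arg_maxP _ R _ (i0, j0) xpredT (fun p => `|X p.1 p.2|)) => // -[u v] _ /= maxX.
have [duv|duv] := eqVneq (d 0 u) (d 0 v).
  apply/eqP; rewrite -normr_le0.
  by apply: le_trans (maxX (i0, j0) isT) _; rewrite (X0 _ _ duv) normr0.
set M := `|X u v| in maxX.
have M0 : 0 <= M by exact: normr_ge0.
suff MM : M <= 0.
  by apply/eqP; rewrite -normr_le0; exact: le_trans (maxX (i0, j0) isT) MM.
pose E := A - diag_mx d.
have nE i j : `|E i j| <= eps by rewrite !mxE; have := nA i j; rewrite !mxE.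
have eq1 : (d 0 u - d 0 v) * X u v = (X *m E) u v - (E *m X) u v.
  have /matrixP/(_ u v) := AX.
  rewrite (_ : A = diag_mx d + E); last by rewrite addrC subrK.
  rewrite mulmxDl mulmxDr mul_diag_mx mul_mx_diag [LHS]mxE [RHS]mxE.
  rewrite [X in X + _ = _]mxE [X in _ = X + _]mxE => H.
  by rewrite mulrBl [d 0 v * _]mulrC; apply/eqP; rewrite subr_eq addrAC eq_sym subr_eq addrC -H addrC.
have b1 : `|(X *m E) u v| <= n%:R * (M * eps).
  rewrite mxE; apply: ler_norm_sumC; first exact: mulr_ge0.
  by move=> k _; rewrite normrM ler_pM // (maxX (u, k)).
have b2 : `|(E *m X) u v| <= n%:R * (M * eps).
  rewrite mxE; apply: ler_norm_sumC; first exact: mulr_ge0.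
  by move=> k _; rewrite normrM mulrC ler_pM // (maxX (k, v)).
have b3 : del * M <= 2 * (n%:R * (M * eps)).
  apply: le_trans (_ : `|(d 0 u - d 0 v) * X u v| <= _).
    by rewrite normrM ler_wpM2r // gap.
  rewrite eq1; apply: le_trans (ler_normB _ _) _.
  by rewrite (_ : 2 = 1 + 1) // mulrDl mul1r lerD.
rewrite leNgt; apply/negP => Mgt0.
have : del <= 2 * (n%:R * eps).
  rewrite -(ler_pM2r Mgt0); apply: le_trans b3 _.
  by rewrite -!mulrA [M * eps]mulrC.
have : 0 <= n%:R * eps by rewrite mulr_ge0.
move: eps_small; lra.
Qed.

(* On the cluster of an eigenvalue [lam] the vector [v] is [a] times a unit
   vector; [v] is then controlled off the cluster by row [j] of [A]. *)
Lemma kernel_bound A (v : 'rV[R]_n) (a lam tau : R) j :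
  near_diag d eps A -> v *m A = lam *: v -> d 0 j = lam ->
  (forall i, d 0 i = lam -> v 0 i = a * (i == j)%:R) ->
  0 <= tau -> (forall l, d 0 l != lam -> `|A j l| <= tau) ->
  forall l, d 0 l != lam ->
    `|v 0 l| <= 2 * `|a| * tau / del /\
    `|(d 0 l - lam) * v 0 l + a * A j l| <= n%:R * (2 * `|a| * tau / del * eps).
Proof.
move=> nA vA dj vC tau0 Atau.
pose E := A - diag_mx d.
have nE i k : `|E i k| <= eps by rewrite !mxE; have := nA i k; rewrite !mxE.
(* Coordinate [l] of [v A = lam v] with [A = D + E]; inside the cluster only the index [j]
   contributes. *)
have eqv l : d 0 l != lam ->
    (d 0 l - lam) * v 0 l + a * A j l = - \sum_(k | d 0 k != lam) v 0 k * E k l.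
  move=> dl.
  have EA : A = diag_mx d + E by rewrite addrC subrK.
  have : v 0 l * d 0 l + \sum_k v 0 k * E k l = lam * v 0 l.
    have /matrixP/(_ 0 l) := vA.
    by rewrite EA mulmxDr mul_mx_diag => H; rewrite !mxE in H *.
  rewrite (bigID (fun k => d 0 k == lam)) /=.
  rewrite (bigD1 j) ?dj //= big1 ?addr0; last first.
    by move=> k /andP[/eqP dk /negbTE kj]; rewrite vC // kj mulr0 mul0r.
  rewrite (vC j) // eqxx mulr1 => H.
  rewrite EA [_ j l]mxE [diag_mx d j l]mxE.
  have -> : (j == l) = false by apply: contraNF dl => /eqP <-; apply/eqP.
  rewrite mulr0n add0r; move: H; set S := \sum_(_ | _) _ => H.
  have -> : S = lam * v 0 l - v 0 l * d 0 l - a * E j l by rewrite -H; ring.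
  ring.
have key V : 0 <= V -> (forall l, d 0 l != lam -> `|v 0 l| <= V) ->
    forall l, d 0 l != lam -> `|(d 0 l - lam) * v 0 l + a * A j l| <= n%:R * (V * eps).
  move=> V0 vV l dl; rewrite eqv // normrN.
  apply: ler_norm_sumC; first exact: mulr_ge0.
  by move=> k dk; rewrite normrM ler_pM // vV.
have bnd : forall l, d 0 l != lam -> `|v 0 l| <= 2 * `|a| * tau / del.
  move=> l0 dl0.
  (* At the largest [V = |v l|] off the cluster the gap absorbs the sum:
     [del V <= V del / 4 + |a| tau], and [2] exceeds [4 / 3]. *)
  case: (@Order.TotalTheory.arg_maxP _ R _ l0 (fun l => d 0 l != lam) (fun l => `|v 0 l|)) => // l dl maxv.
  apply: le_trans (maxv _ dl0) _; rewrite ler_pdivlMr //.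
  have := key _ (normr_ge0 _) maxv l dl.
  set V := `|v 0 l| => H.
  have V0 : 0 <= V by exact: normr_ge0.
  have h1 : del * V <= `|(d 0 l - lam) * v 0 l|.
    by rewrite normrM ler_wpM2r // -dj gap // dj.
  have h2 : `|(d 0 l - lam) * v 0 l| <= n%:R * (V * eps) + `|a| * tau.
    rewrite -[X in `|X|](addrK (a * A j l)).
    apply: le_trans (ler_normB _ _) _; apply: lerD => //.
    by rewrite normrM ler_wpM2l // Atau.
  have h3 : n%:R * (V * eps) <= V * (del / 4).
    rewrite [V * eps]mulrC mulrA mulrC ler_wpM2l //; move: eps_small; lra.
  have h4 : 0 <= `|a| * tau by exact: mulr_ge0.
  rewrite -mulrA; lra.
move=> l dl; split; first exact: bnd.
apply: key => //; apply: divr_ge0 (ltW del_gt0).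
by rewrite !mulr_ge0.
Qed.

(* The kernel vectors are combinations of the rows [Q i] with [d i] in the
   cluster; projecting them to the cluster is injective by [kernel_bound] with
   [a = 0], hence surjective. *)
Lemma cluster_eigenvector (Q : 'M[R]_n) (j : 'I_n) :
  Q^T *m Q = 1%:M -> near_diag d eps (conj_diag d Q) ->
  exists v : 'rV[R]_n, v *m conj_diag d Q = d 0 j *: v /\
    forall i, d 0 i = d 0 j -> v 0 i = (i == j)%:R.
Proof.
move=> QQ nA; set lam := d 0 j.
pose p : 'rV[R]_n := \row_i (d 0 i == lam)%:R.
pose P : 'M[R]_n := diag_mx p.
have QQ' : Q *m Q^T = 1%:M by exact: mulmx1C.
have PP : P *m P = P.
  rewrite mulmx_diag; congr diag_mx; apply/rowP => i; rewrite !mxE.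
  by case: eqP; rewrite ?mulr1 ?mulr0.
have Pd : P *m diag_mx d = lam *: P.
  rewrite mulmx_diag; apply/matrixP => a b; rewrite !mxE.
  by case: (a == b); rewrite ?mulr0 // mulr1n; case: eqP => [->|]; rewrite ?mulr1 ?mulr0 ?mul1r ?mul0r.
have ker (x : 'rV[R]_n) : x *m P *m Q *m conj_diag d Q = lam *: (x *m P *m Q).
  rewrite /conj_diag !mulmxA -(mulmxA (x *m P)) QQ' mulmx1 -(mulmxA x) Pd.
  by rewrite -scalemxAr -!scalemxAl.
have inC (v : 'rV[R]_n) i : (v *m P) 0 i = v 0 i * (d 0 i == lam)%:R.
  by rewrite mul_mx_diag !mxE.
(* [Q] compressed to the cluster and completed by the identity, so that surjectivity becomes
   invertibility of [M]. *)
pose M := P *m Q *m P + (1%:M - P).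
have PN : P *m (1%:M - P) = 0 by rewrite mulmxBr mulmx1 PP subrr.
have MN : M *m (1%:M - P) = 1%:M - P.
  by rewrite /M mulmxDl -(mulmxA (P *m Q)) PN mulmx0 add0r mulmxBl mul1mx PN subr0.
have Mu : M \in unitmx.
  rewrite -row_free_unit -kermx_eq0; apply/rowV0P => x /sub_kermxP xM.
  have xP : x *m (1%:M - P) = 0.
    by rewrite -MN mulmxA xM mul0mx.
  have xPE : x = x *m P by apply/eqP; rewrite -subr_eq0 -{1}(mulmx1 x) -mulmxBr xP.
  have yP : x *m P *m Q *m P = 0.
    by move: xM; rewrite /M mulmxDr xP addr0 !mulmxA.
  have y0 : x *m P *m Q = 0.
    apply/rowP => l; rewrite [RHS]mxE.
    have yC i : d 0 i = lam -> (x *m P *m Q) 0 i = 0 * (i == j)%:R.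
      by move=> di; rewrite mul0r; have := inC (x *m P *m Q) i; rewrite yP mxE di eqxx mulr1.
    have [dl|dl] := eqVneq (d 0 l) lam; first by rewrite yC // mul0r.
    have At k : d 0 k != lam -> `|conj_diag d Q j k| <= eps.
      move=> dk; have := nA j k; rewrite [diag_mx d j k]mxE.
      by rewrite (_ : (j == k) = false) ?subr0 //; apply: contraNF dk => /eqP <-.
    have [+ _] := kernel_bound nA (ker x) erefl yC eps_ge0 At dl.
    by rewrite normr0 mulr0 !mul0r normr_le0 => /eqP.
  by rewrite xPE -[x *m P]mulmx1 -QQ' mulmxA y0 mul0mx.
pose x : 'rV[R]_n := delta_mx 0 j *m invmx M.
have xM : x *m M = delta_mx 0 j by rewrite mulmxKV.
have jP : delta_mx 0 j *m P = delta_mx 0 j :> 'rV[R]_n.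
  apply/rowP => i; rewrite inC !mxE eqxx /=.
  by case: (eqVneq i j) => [->|]; rewrite ?eqxx ?mulr1 ?mul0r.
have xQP : x *m P *m Q *m P = delta_mx 0 j.
  rewrite -[RHS]jP -xM /M mulmxDr mulmxDl -(mulmxA x _ P) -(mulmxA x _ P).
  rewrite -(mulmxA (P *m Q)) PP [(1%:M - P) *m P]mulmxBl mul1mx PP subrr mulmx0 addr0.
  by rewrite !mulmxA.
exists (x *m P *m Q); split; first exact: ker.
move=> i di; have := inC (x *m P *m Q) i.
by rewrite xQP di eqxx mulr1 => <-; rewrite !mxE eqxx.
Qed.

(** On the cluster of [j] the vector [v] is a unit vector, so coordinate [i] of [v A = d j v]
    isolates [A j i]. Off the cluster, [kernel_bound] with [a = 1] puts [v l] close to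
    [- A j l / (d l - d j)]: an approximate Schur complement. *)
Lemma cluster_entryE (Q : 'M[R]_n) (tau : R) (j : 'I_n) (A := conj_diag d Q) :
  Q^T *m Q = 1%:M -> near_diag d eps A -> 0 <= tau ->
  (forall i l, d 0 i != d 0 l -> `|A i l| <= tau) ->
  exists v : 'rV[R]_n,
    (forall i, d 0 i = d 0 j ->
       A j i - diag_mx d j i = - \sum_(l | d 0 l != d 0 j) v 0 l * A l i) /\
    (forall l, d 0 l != d 0 j -> `|v 0 l| <= 2 * tau / del /\
       `|(d 0 l - d 0 j) * v 0 l + A j l| <= n%:R * (2 * tau / del * eps)).
Proof.
move=> QQ nA tau0 At.
have [v [vA vC]] := cluster_eigenvector j QQ nA.
exists v; split=> [i di|l dl].
  have : \sum_k v 0 k * A k i = d 0 j * v 0 i.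
    by move/matrixP/(_ 0 i): (vA); rewrite mxE => ->; rewrite mxE.
  rewrite (vC i) // (bigID (fun k => d 0 k == d 0 j)) /=.
  rewrite (bigD1 j) //= (vC j) // eqxx mul1r big1 ?addr0; last first.
    by move=> k /andP[/eqP dk /negbTE kj]; rewrite vC // kj mul0r.
  set S := \sum_(_ | _) _ => H.
  have -> : A j i = d 0 j * (i == j)%:R - S by rewrite -H addrK.
  by rewrite [diag_mx d j i]mxE eq_sym -mulr_natr; ring.
have vC1 i : d 0 i = d 0 j -> v 0 i = 1 * (i == j)%:R by move=> di; rewrite mul1r vC.
have Atj l' : d 0 l' != d 0 j -> `|A j l'| <= tau by move=> dl'; rewrite At // eq_sym.
have := kernel_bound nA vA erefl vC1 tau0 Atj dl.
by rewrite normr1 mulr1 mul1r.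
Qed.

(** Each term of [cluster_entryE] is a product of two factors of order [tau]. Control of the entries
    between clusters thus extends to all of [A]. *)
Lemma cluster_entry_bound (Q : 'M[R]_n) (tau : R) (A := conj_diag d Q) :
  Q^T *m Q = 1%:M -> near_diag d eps A -> 0 <= tau ->
  (forall i l, d 0 i != d 0 l -> `|A i l| <= tau) ->
  forall i j, d 0 i = d 0 j ->
    `|A j i - diag_mx d j i| <= n%:R * (2 * tau / del * tau).
Proof.
move=> QQ nA tau0 At i j dij.
have [v [vC vN]] := cluster_entryE j QQ nA tau0 At.
rewrite vC // normrN; apply: ler_norm_sumC.
  by apply: mulr_ge0 => //; apply: divr_ge0 (ltW del_gt0); rewrite mulr_ge0.
move=> l dl; have [vl _] := vN l dl.
by rewrite normrM ler_pM // At // dij.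
Qed.

(** Replacing [v l] by [- t w j l / (d l - d j)] in [cluster_entryE] costs an error of order
    [t eps], so the remainder carries a factor [eps] beside [t ^+ 2]. *)
Lemma cluster_entry_expansion (Q w : 'M[R]_n) (t W : R) (A := conj_diag d Q) :
  Q^T *m Q = 1%:M -> near_diag d eps A -> 0 <= t -> 0 <= W ->
  (forall i l, `|w i l| <= W) ->
  (forall i l, d 0 i != d 0 l -> A i l = t * w i l) ->
  forall i j, d 0 i = d 0 j -> i != j ->
    `|A j i - t ^+ 2 * \sum_(l | d 0 l != d 0 j) w j l * w l i / (d 0 l - d 0 j)|
      <= t ^+ 2 * eps * (2 * n%:R ^+ 2 * W ^+ 2 / del ^+ 2).
Proof.
move=> QQ nA t0 W0 wW Aw i j dij ij.
have tau0 : 0 <= t * W by exact: mulr_ge0.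
have At k l : d 0 k != d 0 l -> `|A k l| <= t * W.
  by move=> dkl; rewrite Aw // normrM (ger0_norm t0) ler_wpM2l.
have [v [vC vN]] := cluster_entryE j QQ nA tau0 At.
have := vC i dij; rewrite [diag_mx d j i]mxE eq_sym (negbTE ij) mulr0n subr0 => ->.
rewrite -opprD normrN mulr_sumr -big_split /=.
have -> : t ^+ 2 * eps * (2 * n%:R ^+ 2 * W ^+ 2 / del ^+ 2) =
    n%:R * (n%:R * (2 * (t * W) / del * eps) / del * (t * W)).
  by field; rewrite gt_eqF.
apply: ler_norm_sumC.
  apply: mulr_ge0 => //; apply: divr_ge0 (ltW del_gt0); apply: mulr_ge0 => //.
  by apply: mulr_ge0 => //; apply: divr_ge0 (ltW del_gt0); rewrite mulr_ge0.
move=> l dl; have [_ vl] := vN l dl.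
have dl0 : d 0 l - d 0 j != 0 by rewrite subr_eq0.
have dlg : del <= `|d 0 l - d 0 j| by exact: gap.
have jl : d 0 j != d 0 l by rewrite eq_sym.
rewrite (Aw j l jl) in vl; rewrite (Aw l i) ?dij //.
have -> : v 0 l * (t * w l i) + t ^+ 2 * (w j l * w l i / (d 0 l - d 0 j)) =
    ((d 0 l - d 0 j) * v 0 l + t * w j l) / (d 0 l - d 0 j) * (t * w l i).
  by field.
rewrite normrM; apply: ler_pM => //; last by rewrite normrM (ger0_norm t0) ler_wpM2l.
rewrite normrM normfV; apply: ler_pM => //; first by rewrite invr_ge0.
by rewrite lef_pV2 // posrE // normr_gt0.
Qed.

End NearDiagonal.

(** * Criticality of the misfit *)

Lemma quadratic_ge0_slope0 (R : realFieldType) (L K eta : R) :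
  0 < eta -> (forall b, `|b| < eta -> 0 <= 2 * b * L + b ^+ 2 * K) -> L = 0.
Proof.
move=> eta0 H; apply/eqP/negPn/negP => L0.
have L0' : 0 < `|L| by rewrite normr_gt0.
(* The test point is [b = - tau L] with [tau = eta / den]; the two factors of [den] yield
   [tau |K| < 1] and [tau |L| < eta], and the linear term dominates. *)
pose den := (eta * `|K| + 1) * (`|L| + 1).
have k1 : 1 <= eta * `|K| + 1 by rewrite lerDr mulr_ge0 // ltW.
have l1 : 1 <= `|L| + 1 by rewrite lerDr.
have den0 : 0 < den by rewrite mulr_gt0 // (lt_le_trans ltr01).
pose tau := eta / den.
have tau0 : 0 < tau by rewrite divr_gt0.
have tL : tau * `|L| < eta.
  rewrite /tau mulrAC ltr_pdivrMr // ltr_pM2l //.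
  by apply: lt_le_trans (_ : `|L| + 1 <= _); [rewrite ltrDl|rewrite ler_peMl // (le_trans ler01)].
have tK : tau * `|K| < 1.
  rewrite /tau mulrAC ltr_pdivrMr // mul1r.
  by apply: lt_le_trans (_ : eta * `|K| + 1 <= _); [rewrite ltrDl|rewrite ler_peMr // (le_trans ler01)].
have := H (- tau * L); rewrite normrM normrN (gtr0_norm tau0) => /(_ tL).
rewrite (_ : _ + _ = (tau * L ^+ 2) * (tau * K - 2)); last by ring.
rewrite pmulr_rge0; last by rewrite mulr_gt0 // lt0r sqr_ge0 sqrf_eq0 L0.
rewrite subr_ge0 leNgt => /negP; apply.
apply: le_lt_trans (ler_wpM2l (ltW tau0) (ler_norm K)) _.
by apply: lt_trans tK _; rewrite ltr1n.
Qed.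

(** The sum is half the linear coefficient of [misfit] in [b], and [K] bounds the quadratic one for
    [|b| < 1]. The value [b = 0] is left out because [givens_rest] divides by [b]. *)
Lemma misfit_first_variation (R : realFieldType) n (c W A Y : 'M[R]_n) (C eta : R) :
  0 < eta ->
  (forall b, b != 0 -> `|b| < eta -> exists Z : 'M[R]_n,
     (forall i j, `|Z i j| <= C) /\
     misfit c W A <= misfit c W (A + b *: Y + b ^+ 2 *: Z)) ->
  \sum_i \sum_j c i j * (A i j - W i j) * Y i j = 0.
Proof.
move=> eta0 H.
pose K := \sum_i \sum_j `|c i j| * (2 * `|A i j - W i j| * `|C| + (`|Y i j| + `|C|) ^+ 2).
apply: (@quadratic_ge0_slope0 _ _ K (Num.min eta 1)); first by rewrite lt_min eta0 ltr01.
move=> b; rewrite lt_min => /andP[beta b1].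
have [->|b0] := eqVneq b 0; first by rewrite mulr0 expr0n !mul0r addr0.
have [Z [ZC]] := H b b0 beta.
rewrite -subr_ge0 => H'; apply: le_trans H' _.
rewrite /misfit -sumrB mulr_sumr mulr_sumr -big_split /=; apply: ler_sum => i _.
rewrite -sumrB !mulr_sumr -big_split /=; apply: ler_sum => j _.
rewrite !mxE.
have -> : c i j * (A i j + b * Y i j + b ^+ 2 * Z i j - W i j) ^+ 2 - c i j * (A i j - W i j) ^+ 2
  = 2 * b * (c i j * (A i j - W i j) * Y i j) +
    b ^+ 2 * (c i j * (2 * (A i j - W i j) * Z i j + (Y i j + b * Z i j) ^+ 2)) by ring.
rewrite lerD2l ler_wpM2l ?sqr_ge0 //.
have ZC' : `|Z i j| <= `|C| by apply: le_trans (ZC i j) (ler_norm _).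
apply: le_trans (ler_norm _) _; rewrite normrM ler_wpM2l //.
apply: le_trans (ler_normD _ _) _; apply: lerD.
  by rewrite !normrM ger0_norm // ler_wpM2l // mulr_ge0.
rewrite normrX lerXn2r ?nnegrE ?addr_ge0 //.
apply: le_trans (ler_normD _ _) _; rewrite lerD2l normrM.
by rewrite -[leRHS]mul1r ler_pM // ltW.
Qed.

(** * Rotations in a coordinate plane *)

Section Givens.
Variables (R : rcfType) (n : nat) (i j : 'I_n).
Hypothesis ij : i != j.

Definition givens_skew : 'M[R]_n := delta_mx i j - delta_mx j i.
Definition givens_proj : 'M[R]_n := delta_mx i i + delta_mx j j.
(** Parametrising by the sine [b] makes the cosine a square root and keeps the setting algebraic. *)
Definition givens (b : R) : 'M[R]_n :=
  1%:M + (Num.sqrt (1 - b ^+ 2) - 1) *: givens_proj + b *: givens_skew.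

Local Notation J := givens_skew.
Local Notation P := givens_proj.

Lemma givens_skewT : J^T = - J.
Proof. by rewrite /J linearB /= !trmx_delta opprB. Qed.

Lemma givens_projT : P^T = P.
Proof. by rewrite /P linearD /= !trmx_delta. Qed.

Let mdd := (mul_delta_mx_cond, eqxx, negbTE ij, eq_sym j i, mulr0n, mulr1n).

Lemma givens_PP : P *m P = P.
Proof. by rewrite /P mulmxDl !mulmxDr !mdd addr0 add0r. Qed.

Lemma givens_PJ : P *m J = J.
Proof. by rewrite /P /J mulmxDl !mulmxBr !mdd subr0 sub0r. Qed.

Lemma givens_JP : J *m P = J.
Proof. by rewrite /P /J mulmxBl !mulmxDr !mdd addr0 add0r. Qed.

Lemma givens_JJ : J *m J = - P.
Proof. by rewrite /P /J mulmxBl !mulmxBr !mdd sub0r subr0 opprD addrC. Qed.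

Lemma givensT b : (givens b)^T = 1%:M + (Num.sqrt (1 - b ^+ 2) - 1) *: P - b *: J.
Proof. by rewrite /givens linearD linearD /= !linearZ /= trmx1 givens_projT givens_skewT scalerN. Qed.

Lemma givens_orth b : `|b| <= 1 -> (givens b)^T *m givens b = 1%:M.
Proof.
move=> b1; rewrite givensT /givens; set al := _ - 1.
have al2 : al ^+ 2 + 2 * al + b ^+ 2 = 0.
  have : (al + 1) ^+ 2 = 1 - b ^+ 2.
    by rewrite /al subrK sqr_sqrtr // subr_ge0 -real_normK ?num_real // expr_le1.
  by rewrite sqrrD; lra.
rewrite mulmxBl !mulmxDl !mulmxDr -!scalemxAl -!scalemxAr.
rewrite !mul1mx !mulmx1 givens_PP givens_PJ givens_JP givens_JJ.
move: P J => p q; apply/matrixP => u v; rewrite !mxE.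
rewrite -[RHS]addr0 -[X in _ = _ + X](mul0r (p u v)) -al2.
ring.
Qed.

Definition givens_rest (A : 'M[R]_n) b : 'M[R]_n :=
  let al := Num.sqrt (1 - b ^+ 2) - 1 in
  (al / b ^+ 2) *: (P *m A + A *m P) + (al ^+ 2 / b ^+ 2) *: (P *m A *m P)
  + (al / b) *: (P *m A *m J - J *m A *m P) - J *m A *m J.

Lemma givens_conj A b : b != 0 ->
  (givens b)^T *m A *m givens b =
    A + b *: (A *m J - J *m A) + b ^+ 2 *: givens_rest A b.
Proof.
move=> b0; rewrite givensT /givens /givens_rest; set al := _ - 1.
move: P J => p q; rewrite mulmxBl !mulmxDl mul1mx !mulmxDr.
rewrite -!(scalemxAl, scalemxAr) !mulmx1.
rewrite !mulNmx -!scalemxAl.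
move: (A *m p) (A *m q) (p *m A) (q *m A) => Ap Aq pA qA.
move: (pA *m p) (pA *m q) (qA *m p) (qA *m q) => pAp pAq qAp qAq.
by apply/matrixP => u v; rewrite !mxE; field.
Qed.

(** With [al] the cosine minus one, [al ^+ 2 + 2 al + b ^+ 2 = 0] and [-1 <= al <= 0] give
    [|al| <= b ^+ 2], so every coefficient has modulus at most [1]. *)
Lemma givens_rest_bound A : exists C, forall b, 0 < `|b| <= 1 ->
  forall u v, `|givens_rest A b u v| <= C.
Proof.
pose B u v := `|(P *m A + A *m P) u v| + `|(P *m A *m P) u v|
  + `|(P *m A *m J - J *m A *m P) u v| + `|(J *m A *m J) u v|.
exists (\sum_u \sum_v B u v) => b /andP[b0 b1] u v.
have B0 u' v' : 0 <= B u' v' by rewrite /B !addr_ge0.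
apply: le_trans (_ : B u v <= _); last exact: ler_sum_entry.
rewrite /givens_rest; set al := _ - 1.
have b2 : 0 < b ^+ 2 by rewrite exprn_even_gt0 //= -normr_gt0.
have sq : (al + 1) ^+ 2 = 1 - b ^+ 2.
  by rewrite /al subrK sqr_sqrtr // subr_ge0 -real_normK ?num_real // expr_le1.
have al1 : 0 <= al + 1 by rewrite /al subrK sqrtr_ge0.
have ale0 : al <= 0.
  by rewrite leNgt; apply/negP => al0; move: sq; nra.
have alb : `|al| <= b ^+ 2 by rewrite ler0_norm //; move: sq; nra.
have al1' : `|al| <= 1 by rewrite ler0_norm //; lra.
have c1 : `|al / b ^+ 2| <= 1.
  by rewrite normrM normfV (gtr0_norm b2) ler_pdivrMr // mul1r.
have c2 : `|al ^+ 2 / b ^+ 2| <= 1.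
  rewrite expr2 -mulrA normrM -[leRHS]mul1r; exact: ler_pM.
have c3 : `|al / b| <= 1.
  rewrite normrM normfV ler_pdivrMr // mul1r; apply: le_trans alb _.
  by rewrite -real_normK ?num_real // expr2 ler_piMl.
rewrite [X in `|X|]mxE; apply: le_trans (ler_normD _ _) _; apply: lerD; last first.
  by rewrite mxE normrN.
rewrite [X in `|X|]mxE; apply: le_trans (ler_normD _ _) _; apply: lerD; last first.
  by rewrite mxE normrM ler_piMl.
rewrite [X in `|X|]mxE; apply: le_trans (ler_normD _ _) _; apply: lerD.
  by rewrite mxE normrM ler_piMl.
by rewrite mxE normrM ler_piMl.
Qed.

End Givens.

Lemma mxtrace_mul_delta (R : comNzRingType) n (M : 'M[R]_n) (i j : 'I_n) :
  \tr (M *m delta_mx i j) = M j i.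
Proof.
rewrite /mxtrace (bigD1 j) //= big1 ?addr0 => [|k kj].
  rewrite mxE (bigD1 i) //= big1 => [|l li]; first by rewrite mxE !eqxx mulr1 addr0.
  by rewrite mxE (negbTE li) mulr0.
by rewrite mxE big1 // => l _; rewrite mxE (negbTE kj) andbF mulr0.
Qed.

(* The derivative of [misfit] along the rotation in the plane (i, j) is an entry
   of the commutator of [A] with the weighted residual. *)
Lemma misfit_critical (R : rcfType) n (c W A : 'M[R]_n) (eta : R)
    (X := \matrix_(i, j) (c i j * (A i j - W i j))) :
  A^T = A -> W^T = W -> c^T = c -> 0 < eta ->
  (forall i j b, i != j -> `|b| < eta ->
     misfit c W A <= misfit c W ((givens i j b)^T *m A *m givens i j b)) ->
  A *m X = X *m A.
Proof.
move=> AT WT cT eta0 H.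
have XT : X^T = X.
  apply/matrixP => u v; rewrite !mxE.
  have tr (M : 'M[R]_n) : M^T = M -> M v u = M u v by move=> {1}<-; rewrite mxE.
  by rewrite !tr.
pose L := X *m A - A *m X.
have LT : L^T = - L by rewrite /L linearB /= !trmx_mul AT XT opprB.
(* [L] is skew-symmetric, so its diagonal vanishes anyway. *)
suff L0 i j : i != j -> L i j = 0.
  apply/esym/eqP; rewrite -subr_eq0; apply/eqP/matrixP => i j; rewrite [RHS]mxE.
  have [<-|ij] := eqVneq i j; last exact: L0.
  by have /matrixP/(_ i i) := LT; rewrite -/L !mxE; lra.
move=> ij.
have [C CB] := givens_rest_bound i j A.
have e1 : 0 < Num.min eta 1 by rewrite lt_min eta0 ltr01.
have key := @misfit_first_variation R n c W A (A *m givens_skew R i j - givens_skew R i j *m A) C _ e1.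
have : \sum_u \sum_v c u v * (A u v - W u v) *
   (A *m givens_skew R i j - givens_skew R i j *m A) u v = 0.
  apply: key => b b0; rewrite lt_min => /andP[beta b1].
  exists (givens_rest i j A b); split => [u v|].
    by apply: CB; rewrite normr_gt0 b0 ltW.
  by rewrite -givens_conj //; exact: H.
set Y := _ - _ *m A => S0.
(* With [J] the skew generator, cyclicity of the trace gives [tr (X (A J - J A)) = tr (L J) = L j i
   - L i j = - 2 L i j]. *)
have : \tr (X *m Y) = 0.
  rewrite -[RHS]S0 exchange_big /mxtrace; apply: eq_bigr => u _.
  rewrite mxE; apply: eq_bigr => v _; congr (_ * _).
  by rewrite -{1}XT !mxE.
rewrite /Y mulmxBr !mulmxA linearB /= [X in _ - X]mxtrace_mulC mulmxA.
rewrite -linearB /= -mulmxBl -/L /givens_skew mulmxBr linearB /= !mxtrace_mul_delta.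
have /matrixP/(_ i j) := LT; rewrite [_^T i j]mxE [(- L) i j]mxE => ->.
lra.
Qed.

(** * Minimisation *)

From mathcomp Require Import classical_sets reals topology normedtype derive.
From mathcomp Require Import Rstruct_topology.
Import numFieldNormedType.Exports.

Lemma orth_entry_le1 (R : realType) n (Q : 'M[R]_n) i j :
  Q^T *m Q = 1%:M -> `|Q i j| <= 1.
Proof.
move=> /matrixP/(_ j j); rewrite !mxE eqxx => H.
rewrite -(ler_pXn2r (n:=2)) ?nnegrE // expr1n real_normK ?num_real // -[leRHS]H.
rewrite (bigD1 i) //= mxE -expr2 lerDl sumr_ge0 // => k _.
by rewrite mxE -expr2 sqr_ge0.
Qed.

Local Open Scope classical_set_scope.

Lemma continuous_sumr (R : realType) (T : topologicalType) (I : Type) (s : seq I)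
    (f : I -> T -> R) :
  (forall i, continuous (f i)) -> continuous (fun x => \sum_(i <- s) f i x).
Proof.
move=> cf; elim: s => [|i s IH] x.
  under eq_fun do rewrite big_nil; exact: cvg_cst.
under eq_fun do rewrite big_cons.
by apply: cvgD; [exact: cf | exact: IH].
Qed.

(** Extreme value theorem: the constraints are closed, orthogonal matrices have entries of modulus
    at most [1], and the identity is admissible. Matrices are flattened to row vectors for
    [bounded_closed_compact]. *)
Lemma misfit_min (R : realType) n (d : 'rV[R]_n) (c W : 'M[R]_n) (eps : R) :
  0 <= eps ->
  exists Q : 'M[R]_n, [/\ Q^T *m Q = 1%:M, near_diag d eps (conj_diag d Q) &
    forall Q' : 'M[R]_n, Q'^T *m Q' = 1%:M -> near_diag d eps (conj_diag d Q') ->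
      misfit c W (conj_diag d Q) <= misfit c W (conj_diag d Q')].
Proof.
move=> eps0.
pose K : set 'rV[R]_(n * n) := [set q | (vec_mx q)^T *m vec_mx q = 1%:M] `&`
   [set q | near_diag d eps (conj_diag d (vec_mx q))].
have cent i j : continuous (fun q : 'rV[R]_(n * n) => vec_mx q i j).
  move=> q; under eq_fun do rewrite mxE; exact: coord_continuous.
have cA i j : continuous (fun q : 'rV[R]_(n * n) => conj_diag d (vec_mx q) i j).
  under eq_fun do rewrite conj_diagE.
  apply: continuous_sumr => k q.
  exact: cvgM (cvgM (cent _ _ _) (cvg_cst _)) (cent _ _ _).
have cG i j : continuous (fun q : 'rV[R]_(n * n) => ((vec_mx q)^T *m vec_mx q) i j).
  under eq_fun do rewrite mxE; apply: continuous_sumr => k q.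
  by under eq_fun do rewrite mxE; exact: cvgM (cent _ _ _) (cent _ _ _).
have clK : closed K.
  apply: closedI.
    rewrite [X in closed X](_ : _ = \bigcap_(p in [set: 'I_n * 'I_n])
        ((fun q => ((vec_mx q)^T *m vec_mx q) p.1 p.2) @^-1` [set (1%:M : 'M[R]_n) p.1 p.2])).
      by apply: closed_bigI => p _; apply: preimage_closed; [move=> q _; exact: cG|exact: closed_eq].
    apply/seteqP; split => [q /= qo p _ /=|q /= H]; first by rewrite qo.
    by apply/matrixP => i j; exact: (H (i, j) I).
  rewrite [X in closed X](_ : _ = \bigcap_(p in [set: 'I_n * 'I_n])
      ((fun q => `|conj_diag d (vec_mx q) p.1 p.2 - diag_mx d p.1 p.2|) @^-1` [set x | x <= eps])).
    apply: closed_bigI => p _; apply: preimage_closed; last exact: closed_le.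
      move=> q _.
    exact: cvg_norm (cvgB (cA p.1 p.2 q) (cvg_cst (diag_mx d p.1 p.2))).
  apply/seteqP; split => [q /= H p _ /=|q /= H i j]; first exact: H.
  exact: (H (i, j) I).
have bK : bounded_set K.
  exists 1; split; first exact: num_real.
  move=> M M1 q [/= qo _]; rewrite [leLHS]/Num.norm /= mx_normrE.
  apply/bigmax_leP; split => [|[a b] _ /=]; first exact: ltW (lt_trans ltr01 M1).
  apply: le_trans (ltW M1); rewrite ord1.
  case/mxvec_indexP: b => i j; rewrite -{1}(vec_mxK q) mxvecE.
  exact: orth_entry_le1.
have K0 : K !=set0.
  exists (mxvec 1%:M); split => /=; rewrite mxvecK ?trmx1 ?mulmx1 // => i j.
  by rewrite /conj_diag trmx1 mul1mx mulmx1 subrr normr0.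
have cf : {within K, continuous (fun q => misfit c W (conj_diag d (vec_mx q)))}.
  apply: continuous_subspaceT.
  apply: continuous_sumr => i; apply: continuous_sumr => j q.
  have cB : (conj_diag d (vec_mx x) i j - W i j) @[x --> q] -->
      (conj_diag d (vec_mx q) i j - W i j).
    exact: cvgB (cA i j q) (cvg_cst (W i j)).
  exact: cvgM (cvg_cst _) (cvgM cB cB).
have [q] := compact_EVT_min K0 (bounded_closed_compact bK clK) cf.
rewrite inE => -[/= qo qn] qmin; exists (vec_mx q); split => // Q' Q'o Q'n.
rewrite -(mxvecK Q'); apply: qmin; rewrite inE.
by split; rewrite /= mxvecK.
Qed.

Local Close Scope classical_set_scope.

(** * Generic weights and small rotations *)

Lemma poly_nonroot (R : numFieldType) (q : {poly R}) :
  q != 0 -> exists x : R, q.[x] != 0.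
Proof.
move=> q0; pose rs : seq R := [seq i%:R | i <- iota 0 (size q)].
have urs : uniq rs.
  by rewrite map_inj_uniq ?iota_uniq // => a b /eqP; rewrite eqr_nat => /eqP.
have [ars|] := boolP (all (root q) rs).
  by have := max_poly_roots q0 ars urs; rewrite size_map size_iota ltnn.
by case/allPn => x _ qx; exists x.
Qed.

(** With [w i j = x ^+ i * x ^+ j] on edges, the sum is [x ^+ i * x ^+ j * (p i j).[x]], where
    distinct [l] contribute distinct powers ['X^(l.*2)]. The assumed common neighbour makes [p i j]
    nonzero, and one [x] avoids the roots of all these polynomials. *)
Lemma generic_weights (R : realFieldType) n (e : rel 'I_n) (d : 'rV[R]_n) :
  symmetric e ->
  (forall i j, i != j -> d 0 i = d 0 j -> exists l, [/\ e i l, e j l & d 0 l != d 0 i]) ->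
  exists w : 'M[R]_n, [/\ w^T = w, forall i j, (w i j != 0) = e i j &
    forall i j, i != j -> d 0 i = d 0 j ->
      \sum_(l | d 0 l != d 0 j) w j l * w l i / (d 0 l - d 0 j) != 0].
Proof.
move=> es H.
pose a i j l : R := if [&& e j l, e l i & d 0 l != d 0 j] then (d 0 l - d 0 j)^-1 else 0.
pose p i j : {poly R} := \sum_l a i j l *: 'X^(l.*2).
have pN0 i j : i != j -> d 0 i = d 0 j -> p i j != 0.
  move=> ij dij; have [l [eil ejl dl]] := H i j ij dij.
  have : (p i j)`_(l.*2) != 0.
    rewrite /p coef_sum (bigD1 l) //= big1 => [|k kl].
      rewrite coefZ coefXn eqxx mulr1 addr0 /a ejl es eil -dij dl.
      by rewrite invr_eq0 subr_eq0.
    rewrite coefZ coefXn (_ : (_ == _) = false) ?mulr0 //.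
    by apply: contraNF kl => /eqP/double_inj/ord_inj ->.
  by apply: contraNneq => ->; rewrite coef0.
pose P (u : 'I_n * 'I_n) := (u.1 != u.2) && (d 0 u.1 == d 0 u.2).
have qN0 : 'X * \prod_(u | P u) p u.1 u.2 != 0.
  rewrite mulf_neq0 ?polyX_eq0 //; apply/prodf_neq0 => u /andP[u1 /eqP u2].
  exact: pN0.
have [x] := poly_nonroot qN0.
rewrite hornerM hornerX mulf_eq0 negb_or => /andP[x0].
rewrite horner_prod => /prodf_neq0 px.
exists (\matrix_(i, j) ((e i j)%:R * (x ^+ i * x ^+ j))); split.
- by apply/matrixP => i j; rewrite !mxE es [x ^+ i * _]mulrC.
- move=> i j; rewrite mxE; case: (e i j); last by rewrite mul0r eqxx.
  by rewrite mul1r mulf_neq0 // expf_neq0.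
move=> i j ij dij.
have := px (i, j); rewrite /P /= ij dij eqxx => /(_ isT).
suff -> : \sum_(l | d 0 l != d 0 j) (\matrix_(i, j) ((e i j)%:R * (x ^+ i * x ^+ j))) j l *
    (\matrix_(i, j) ((e i j)%:R * (x ^+ i * x ^+ j))) l i / (d 0 l - d 0 j) =
    x ^+ i * x ^+ j * (p i j).[x].
  by move=> pij; rewrite !mulf_neq0 // expf_neq0.
rewrite /p horner_sum mulr_sumr big_mkcond /=; apply: eq_bigr => l _.
rewrite hornerZ hornerXn !mxE /a; case: (e j l); last by rewrite !mul0r mulr0 if_same.
case: (e l i); last by rewrite !mul0r mulr0 !mul0r mulr0 if_same.
case: ifP => _ /=; last by rewrite mul0r mulr0.
by rewrite -mul2n exprM expr2 [(x * x) ^+ l]exprMn; ring.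
Qed.

(** Makes small rotations admissible competitors of a minimiser lying strictly inside the
    constraint. *)
Lemma givens_near (R : rcfType) n (A : 'M[R]_n) (eps : R) : 0 < eps ->
  exists2 eta, 0 < eta & forall i j b, i != j -> `|b| < eta ->
    forall u v, `|((givens i j b)^T *m A *m givens i j b) u v - A u v| <= eps.
Proof.
move=> eps0.
have H (q : 'I_n * 'I_n) : exists eta, 0 < eta /\ (q.1 != q.2 -> forall b, `|b| < eta ->
    forall u v, `|((givens q.1 q.2 b)^T *m A *m givens q.1 q.2 b) u v - A u v| <= eps).
  case: q => i j /=; have [|ij] := boolP (i == j); first by exists 1.
  have [C CB] := givens_rest_bound i j A.
  pose Y := A *m givens_skew R i j - givens_skew R i j *m A.
  pose K := `|C| + \sum_u \sum_v `|Y u v|.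
  have S0 : 0 <= \sum_u \sum_v `|Y u v| by apply: sumr_ge0 => u _; exact: sumr_ge0.
  have K0 : 0 <= K by rewrite addr_ge0.
  exists (Num.min 1 (eps / (K + 1))); split.
    by rewrite lt_min ltr01 divr_gt0 // ltr_wpDl.
  move=> _ b; rewrite lt_min => /andP[b1 be] u v.
  have [->|b0] := eqVneq b 0.
    rewrite /givens expr0n subr0 sqrtr1 subrr !scale0r !addr0 trmx1 mul1mx mulmx1.
    by rewrite subrr normr0 ltW.
  have aux (M Z : 'M[R]_n) :
      (A + b *: M + b ^+ 2 *: Z) u v - A u v = b * M u v + b ^+ 2 * Z u v.
    by rewrite !mxE; ring.
  rewrite givens_conj // -/Y aux; apply: le_trans (_ : `|b| * (K + 1) <= _).
    apply: le_trans (ler_normD _ _) _.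
    apply: le_trans (_ : `|b| * (\sum_u \sum_v `|Y u v|) + `|b| * `|C| <= _); last first.
      by rewrite -mulrDr ler_wpM2l // /K addrC lerDl.
    apply: lerD.
      by rewrite normrM ler_wpM2l //; exact: (ler_sum_entry (f := fun u v => `|Y u v|)).
    rewrite normrM normrX ler_pM ?exprn_ge0 //.
      by rewrite expr2 ler_piMl // ltW.
    by apply: le_trans (ler_norm _); apply: CB; rewrite normr_gt0 b0 ltW.
  by apply/ltW; rewrite -ltr_pdivlMr // ltr_wpDl.
have [f Hf] := fin_all_exists H.
have [eta eta0 etaf] := @fin_lower_bound R _ xpredT f (fun q _ => (Hf q).1).
exists eta => // i j b ij be; apply: (Hf (i, j)).2 => //.
exact: lt_le_trans be (etaf _ _).
Qed.

(** * The matrix with prescribed spectrum and pattern *)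

Lemma char_poly_conj_diag (R : realFieldType) n (d : 'rV[R]_n) (Q : 'M[R]_n) :
  Q^T *m Q = 1%:M -> char_poly (conj_diag d Q) = \prod_i ('X - (d 0 i)%:P).
Proof.
move=> QQ; pose pQ := map_mx (@polyC R) Q.
have pQT : map_mx (@polyC R) Q^T = pQ^T by apply/matrixP => i j; rewrite !mxE.
have pQQ : pQ^T *m pQ = 1%:M by rewrite -pQT -map_mxM QQ map_mx1.
have -> : \prod_i ('X - (d 0 i)%:P) = char_poly (diag_mx d).
  rewrite char_poly_trig ?diag_mx_is_trig //; apply: eq_bigr => i _.
  by rewrite mxE eqxx mulr1n.
rewrite /char_poly.
have -> : char_poly_mx (conj_diag d Q) = pQ^T *m char_poly_mx (diag_mx d) *m pQ.
  rewrite /char_poly_mx mulmxBr mulmxBl /conj_diag !map_mxM pQT.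
  by rewrite (scalar_mxC _ pQ^T) -(mulmxA 'X%:M) pQQ mulmx1.
by rewrite !det_mulmx mulrAC -det_mulmx pQQ det1 mul1r.
Qed.

Theorem isospectral_pattern (R : realType) n (e : rel 'I_n) (d : 'rV[R]_n) :
  symmetric e ->
  (forall i j, i != j -> d 0 i = d 0 j -> e i j) ->
  (forall i j, i != j -> d 0 i = d 0 j -> exists l, [/\ e i l, e j l & d 0 l != d 0 i]) ->
  exists A : 'M[R]_n, [/\ A^T = A, forall i j, i != j -> (A i j != 0) = e i j,
    char_poly A = \prod_i ('X - (d 0 i)%:P) &
    forall X : 'M[R]_n, (forall i j, A i j * X i j = 0) -> (forall i, X i i = 0) ->
      A *m X = X *m A -> X = 0].
Proof.
move=> es ed el.
have [w [wT we wS]] := generic_weights es el.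
have [del del0 gap] := @fin_lower_bound R ('I_n * 'I_n)%type (fun u => d 0 u.1 != d 0 u.2)
  (fun u => `|d 0 u.1 - d 0 u.2|) ltac:(by move=> u; rewrite normr_gt0 subr_eq0).
pose sg i j := \sum_(l | d 0 l != d 0 j) w j l * w l i / (d 0 l - d 0 j).
have [kap kap0 kapP] := @fin_lower_bound R ('I_n * 'I_n)%type
  (fun u => (u.1 != u.2) && (d 0 u.1 == d 0 u.2)) (fun u => `|sg u.1 u.2|)
  ltac:(by move=> u /andP[u1 /eqP u2]; rewrite normr_gt0; exact: wS).
pose W := \sum_i \sum_j `|w i j|.
have W0 : 0 <= W by apply: sumr_ge0 => i _; exact: sumr_ge0.
have wW i j : `|w i j| <= W.
  exact: (ler_sum_entry (f := fun u v => `|w u v|)).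
pose B := 2 * n%:R ^+ 2 * W ^+ 2 / del ^+ 2.
have B0 : 0 <= B.
  by rewrite /B; apply: divr_ge0; rewrite ?sqr_ge0 // !mulr_ge0 ?sqr_ge0.
pose c : 'M[R]_n := \matrix_(i, j) (d 0 i != d 0 j)%:R.
pose S := misfit c w 0.
have S0 : 0 <= S.
  by apply: sumr_ge0 => i _; apply: sumr_ge0 => j _; rewrite !mxE mulr_ge0 ?sqr_ge0.
(* [eps] is small against the gap, and also against [kap / B], so that the remainder of
   [cluster_entry_expansion] stays below the leading coefficient. *)
have [eps [eps0 epsdel epskap]] : exists eps : R, [/\ 0 < eps, 4 * (n%:R * eps) < del & eps * B < kap].
  exists (Num.min (del / (4 * n%:R + 1)) (kap / (B + 1))).
  have n0 : 0 < 4 * n%:R + 1 :> R by rewrite ltr_wpDl // mulr_ge0.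
  have B1 : 0 < B + 1 by rewrite ltr_wpDl.
  set m := Num.min _ _.
  have m0 : 0 < m by rewrite lt_min !divr_gt0.
  have m1 : m * (4 * n%:R + 1) <= del by rewrite -ler_pdivlMr // ge_min lexx.
  have m2 : m * (B + 1) <= kap by rewrite -ler_pdivlMr // ge_min lexx orbT.
  by split => //; lra.
pose M := W + S + 1.
have M0 : 0 < M by rewrite ltr_wpDl // addr_ge0.
have [t [t0 tM]] : exists t : R, 0 < t /\ t * M = eps / 2.
  by exists (eps / 2 / M); rewrite !divr_gt0 // divfK // gt_eqF.
have [Q [QQ nQ Qmin]] := misfit_min d c (t *: w) (ltW eps0).
set A := conj_diag d Q in nQ Qmin.
have gap' i j : d 0 i != d 0 j -> del <= `|d 0 i - d 0 j| by exact: (gap (i, j)).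
have AT : A^T = A by rewrite /A /conj_diag !trmx_mul trmxK tr_diag_mx mulmxA.
have cE i l : d 0 i != d 0 l -> c i l = 1 by move=> dil; rewrite mxE dil.
have c0 i l : 0 <= c i l by rewrite mxE.
have DilN i l : d 0 i != d 0 l -> diag_mx d i l = 0.
  by rewrite mxE; have [->|] := eqVneq i l; rewrite ?eqxx.
(* The competitor [1%:M] gives the diagonal matrix itself, with misfit [t ^+ 2 * S]. *)
have misA : misfit c (t *: w) A <= t ^+ 2 * S.
  apply: le_trans (Qmin 1%:M _ _) _; rewrite ?trmx1 ?mulmx1 // /conj_diag ?trmx1 ?mulmx1 ?mul1mx.
    by move=> i j; rewrite subrr normr0 ltW.
  rewrite /S /misfit mulr_sumr; apply: ler_sum => i _; rewrite mulr_sumr; apply: ler_sum => j _.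
  have [dij|dij] := eqVneq (d 0 i) (d 0 j).
    by rewrite mxE dij eqxx !mul0r mulr0.
  by rewrite DilN // le_eqVlt !mxE; apply/orP; left; apply/eqP; ring.
have cross i l : d 0 i != d 0 l -> `|A i l| <= eps / 2.
  (* [S + 1] stands in for a square root of [S], since [S <= (S + 1) ^+ 2]; this is why [M] contains
     [S + 1]. *)
  move=> dil; have r1 : `|A i l - t * w i l| <= t * (S + 1).
    rewrite -(ler_pXn2r (n := 2)) ?nnegrE ?mulr_ge0 ?addr_ge0 ?(ltW t0) //.
    rewrite real_normK ?num_real //.
    apply: le_trans (_ : t ^+ 2 * S <= _).
      apply: le_trans misA.
      have := @ler_sum_entry R _ _ (fun i l => c i l * (A i l - (t *: w) i l) ^+ 2) i l.
      by rewrite cE // mul1r [(t *: w) i l]mxE; apply => a b; rewrite mulr_ge0 ?sqr_ge0.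
    rewrite (exprMn _ t) ler_wpM2l ?sqr_ge0 //; nra.
  rewrite -tM -[A i l](subrK (t * w i l)); apply: le_trans (ler_normD _ _) _.
  rewrite /M -addrA [W + _]addrC mulrDr lerD // normrM (gtr0_norm t0).
  by rewrite ler_wpM2l // ltW.
have e20 : 0 <= eps / 2 by rewrite ltW // divr_gt0.
(* The constraint holds with room to spare, so all small rotations of the minimiser compete. *)
have nA : near_diag d (eps / 2) A.
  move=> i j; have [dij|dij] := eqVneq (d 0 i) (d 0 j); last by rewrite DilN // subr0 cross.
  have := cluster_entry_bound (ltW eps0) gap' epsdel QQ nQ e20 cross (esym dij).
  move/le_trans; apply.
  have -> : n%:R * (2 * (eps / 2) / del * (eps / 2)) = (n%:R * eps / del) * (eps / 2).
    by field; rewrite gt_eqF.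
  rewrite ler_piMl // ler_pdivrMr // mul1r.
  have : 0 <= n%:R * eps by rewrite mulr_ge0 // ltW.
  move: epsdel; lra.
(* Criticality makes the residual [X] commute with [A]; the weights [c] kill it on the clusters, so
   it is zero. *)
have Acr i l : d 0 i != d 0 l -> A i l = t * w i l.
  move=> dil.
  have [eta eta0 etaP] := givens_near A (divr_gt0 eps0 (ltr0n _ 2)).
  pose X := \matrix_(i, j) (c i j * (A i j - (t *: w) i j)).
  have AX : A *m X = X *m A.
    have eta1 : 0 < Num.min eta 1 by rewrite lt_min eta0 ltr01.
    apply: misfit_critical eta1 _ => //.
    - by rewrite linearZ /= wT.
    - by apply/matrixP => a b; rewrite !mxE eq_sym.
    move=> a b be ab beb.
    have GA : (givens a b be)^T *m A *m givens a b be = conj_diag d (Q *m givens a b be).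
      by rewrite /A /conj_diag trmx_mul !mulmxA.
    rewrite GA; apply: Qmin.
      rewrite trmx_mul mulmxA -(mulmxA _ Q^T) QQ mulmx1 givens_orth //.
      by apply: ltW; apply: lt_le_trans beb _; rewrite ge_min lexx orbT.
    rewrite -GA => u v.
    rewrite -[X in X - _](subrK (A u v)) -addrA [leRHS]splitr.
    apply: le_trans (ler_normD _ _) (lerD _ (nA u v)); apply: etaP => //.
    by apply: lt_le_trans beb _; rewrite ge_min lexx.
  have X0 : X = 0.
    apply: (commute_near_diag (ltW eps0) gap' epsdel nQ AX) => a b dab.
    by rewrite mxE [c a b]mxE dab eqxx mul0r.
  have /matrixP/(_ i l) := X0; rewrite mxE cE // mul1r [(0 : 'M__) i l]mxE [(t *: w) i l]mxE.
  by move/eqP; rewrite subr_eq0 => /eqP.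
have Ae i j : i != j -> (A i j != 0) = e i j.
  move=> ij; have [dij|dij] := eqVneq (d 0 i) (d 0 j); last first.
    by rewrite Acr // mulf_eq0 gt_eqF //= we.
  rewrite ed //.
  (* A zero entry inside a cluster would force the leading coefficient, at least [kap] in modulus,
     down to [eps * B < kap]. *)
  have := cluster_entry_expansion (ltW eps0) gap' epsdel QQ nQ (ltW t0) W0 wW Acr (esym dij).
  rewrite eq_sym => /(_ ij); rewrite -/A -/B -/(sg j i) => H.
  apply/negP => /eqP Aij; move: H; rewrite Aij sub0r normrN normrM ger0_norm ?sqr_ge0 //.
  rewrite -mulrA ler_pM2l ?exprn_gt0 // leNgt => /negP; apply.
  by apply: lt_le_trans epskap (kapP (j, i) _); rewrite /= eq_sym ij dij eqxx.
exists A; split => //; first exact: char_poly_conj_diag.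
move=> X AX Xd comm.
(* On a cluster [X] vanishes: on the diagonal by assumption, elsewhere because [A] is nonzero
   there. *)
apply: (commute_near_diag (ltW eps0) gap' epsdel nQ comm) => i j dij.
have [->|ij] := eqVneq i j; first exact: Xd.
have := AX i j; move/eqP; rewrite mulf_eq0 => /orP[/idPn|/eqP //].
by rewrite Ae // ed.
Qed.

Theorem theorem4p6 (m1 : nat) (ms : seq nat) (n : nat) (e : rel 'I_n)
  (Hm1 : leq 1 m1) (Hms : all (leq 1) ms)
  (HG : simple_graph e) (HBG : in_BG e (map S (m1 :: ms)))
  (k : nat) (Hk1 : leq 1 k) (Hk2 : leq k m1)
  (r : seq nat) (Hr : refinement (k :: subn m1.+1 k :: ms) r)
  (sigma : seq R) (Hsig : perm_eq (mult_list sigma) r) :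
  exists A : 'M[R]_n, [/\ in_SG e A, SSP A & spectrum_is A sigma].
Proof.
have hk : leq 1 k && leq k m1 by rewrite Hk1.
have [gamma [gammaC gammaE]] := in_BG_labels HG HBG hk.
have [g gP] := refinement_labels Hr Hsig.
have [|d ds gd] := @assign_values R 0 n gamma g sigma.
  by move=> j; rewrite gP gammaC.
(* [g] recovers the label from the eigenvalue, so [gammaE] applies to vertices with equal values. *)
have same i j : d i = d j -> gamma i = gamma j by rewrite -!gd => ->.
have [es _] := HG.
have [i j ij|i j ij|A [AT Ae Ac Assp]] := @isospectral_pattern R n e (\row_i d i) es.
- by rewrite !mxE => /same /(gammaE _ _ ij)[].
- rewrite !mxE => /same /(gammaE _ _ ij)[_ [l [il jl gl]]]; exists l; split=> //.
  by rewrite mxE; apply: contraNneq gl => /same ->.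
exists A; split=> //; first by move=> X _; exact: Assp.
rewrite /spectrum_is Ac -(perm_big _ ds) big_map big_enum.
by apply: eq_bigr => i _; rewrite mxE.
Qed.
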